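(* Let $H$ be a complex Hilbert space, let $A$ be a not necessarily bounded operator in $H$ which is boundedly invertible, and let $T\in B(H)$. If $TA^p\subset A^pT$ and $TA^q\subset A^qT$ for some relatively prime positive integers $p$ and $q$, then $TA\subset AT$.
   Context: Operators are linear and not necessarily bounded. Products and powers are defined on natural domains: $D(RS)=\{x\in D(S):Sx\in D(R)\}$. $R\subset S$ means $D(R)\subset D(S)$ and $R$ and $S$ coincide on $D(R)$. $B(H)$ is the algebra of bounded everywhere defined linear operators on $H$. $A$ is boundedly invertible if there is $B\in B(H)$ such that $AB=I$ and $BA\subset I$. *)

(* Defs.v *)
From HB Require Import structures.
From mathcomp Require Import all_boot all_order all_algebra.
From mathcomp Require Import sesquilinear complex.
From mathcomp Require Import all_classical reals topology normedtype.

Set Implicit Arguments.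
Unset Strict Implicit.
Unset Printing Implicit Defensive.

Import Order.TTheory GRing.Theory Num.Theory.
Import numFieldNormedType.Exports.

Local Open Scope classical_set_scope.
Local Open Scope ring_scope.
Local Open Scope complex_scope.

(* Completeness is that of the norm, which [normE] forces to be the norm of
   the inner product.  [{dot H for Num.conj}] is linear on the left and
   conjugate-linear on the right. *)
HB.mixin Record hasInnerProduct (R : realType) (H : Type)
    of CompleteNormedModule R[i] H := {
  inner : {dot H for (@Num.conj R[i])};
  normE : forall x : H, `|x| ^+ 2 = inner x x
}.

#[short(type="hilbertType")]
HB.structure Definition Hilbert (R : realType) :=
  {H of hasInnerProduct R H & CompleteNormedModule R[i] H}.

Section Operators.
Context {R : realType} {H : hilbertType R}.

(* The values of [app] outside [dom] carry no meaning: every notion below only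
   looks at values on domains. *)
Record operator := Operator {
  dom : set H;
  app :> H -> H;
  dom0 : dom 0;
  dom_lin : forall (a : R[i]) x y, dom x -> dom y -> dom (a *: x + y);
  app_lin : forall (a : R[i]) x y, dom x -> dom y ->
    app (a *: x + y) = a *: app x + app y
}.

Definition op_sub (S T : operator) : Prop :=
  dom S `<=` dom T /\ forall x, dom S x -> S x = T x.

Definition op_eq (S T : operator) : Prop := op_sub S T /\ op_sub T S.

Definition op_id : operator :=
  @Operator setT id I (fun _ _ _ _ _ => I) (fun _ _ _ _ _ => erefl).

Section Product.
Variables S T : operator.

Let mul_dom := [set x | dom T x /\ dom S (T x)].

Let app_0 : T 0 = 0.
Proof.
by have := app_lin (-1) (dom0 T) (dom0 T); rewrite !scaleN1r !addNr.
Qed.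

Let mul_dom0 : mul_dom 0.
Proof. by split; rewrite ?app_0; exact: dom0. Qed.

Let mul_dom_lin (a : R[i]) x y :
  mul_dom x -> mul_dom y -> mul_dom (a *: x + y).
Proof.
by move=> [Tx STx] [Ty STy]; split; rewrite ?app_lin//; exact: dom_lin.
Qed.

Let mul_app_lin (a : R[i]) x y : mul_dom x -> mul_dom y ->
  (S \o T) (a *: x + y) = a *: (S \o T) x + (S \o T) y.
Proof. by move=> [Tx STx] [Ty STy]; rewrite /= !app_lin. Qed.

Definition op_mul : operator := Operator mul_dom0 mul_dom_lin mul_app_lin.

End Product.

Definition op_pow (A : operator) (n : nat) : operator :=
  iter n (op_mul A) op_id.

Definition bounded_everywhere (T : operator) : Prop :=
  dom T = setT /\ exists M : R, forall x : H, `|T x| <= M%:C * `|x|.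

Definition boundedly_invertible (A : operator) : Prop :=
  exists B : operator, [/\ bounded_everywhere B,
    op_eq (op_mul A B) op_id & op_sub (op_mul B A) op_id].

End Operators.

Arguments operator {R} H.

Declare Scope operator_scope.
Delimit Scope operator_scope with op.
Bind Scope operator_scope with operator.
Notation "S * T" := (op_mul S T) : operator_scope.
Notation "A ^+ n" := (op_pow A n) : operator_scope.
Notation "S `<=` T" := (op_sub S T) : operator_scope.

(* Main.v *)
Require Import Defs.
From HB Require Import structures.
From mathcomp Require Import all_boot all_order all_algebra.
From mathcomp Require Import sesquilinear complex.
From mathcomp Require Import all_classical reals topology normedtype.

(** Let [B] be the bounded inverse of [A].  The inclusion
    [T * A ^+ n `<=` A ^+ n * T] says that [T] commutes with [B ^+ n].  If
    [u * p = v * q + 1], then [B ^+ (v * q) * (B * T) = T * B ^+ (u * p)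
    = B ^+ (v * q) * (T * B)], and injectivity of [B] gives [B * T = T * B],
    which is the claim for [A]. *)

Lemma comp_iter_mul {X : Type} {f g : X -> X} (m : nat) {n : nat} :
  (forall x, g (iter n f x) = iter n f (g x)) ->
  forall x, g (iter (m * n)%N f x) = iter (m * n)%N f (g x).
Proof.
by move=> fg x; elim: m => [|m IHm] //; rewrite mulSn !iterD fg IHm.
Qed.

Lemma comp_iter_coprime {X : Type} {f g : X -> X} {p q : nat} :
  injective f -> (0 < p)%N -> coprime p q ->
  (forall x, g (iter p f x) = iter p f (g x)) ->
  (forall x, g (iter q f x) = iter q f (g x)) ->
  forall x, g (f x) = f (g x).
Proof.
move=> f_inj p_gt0 /eqP pq1 fgp fgq x.
have [u v def_u _] := egcdnP q p_gt0.
rewrite pq1 addn1 in def_u.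
(* Bézout suggests [f = f^(u * p) f^(- v * q)]; cancelling [iter (v * q) f] stands in for the
   negative power. *)
have iter_inj n : injective (iter n f).
  by elim: n => [|n IHn] // y z /f_inj /IHn.
apply: (iter_inj (v * q)%N).
by rewrite -(comp_iter_mul v fgq) -!iterSr -def_u (comp_iter_mul u fgp).
Qed.

Local Open Scope operator_scope.

Section InverseOperator.
Context {R : realType} {H : hilbertType R}.
Variables (A : operator H) (B : H -> H).
Hypothesis domAB : forall y, dom A (B y).
Hypothesis ABK : forall y, A (B y) = y.
Hypothesis BAK : forall x, dom A x -> B (A x) = x.

Lemma op_pow_iter_inv (n : nat) (y : H) :
  dom (A ^+ n) (iter n B y) /\ (A ^+ n) (iter n B y) = y.
Proof.
(* [A ^+ n.+1] applies its extra [A] last, so it must meet the innermost [B]: [A ^+ n] brings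
   [iter n B (B y)] back to [B y], which lies in [dom A]. *)
elim: n y => [|n IHn] y //; have [dn en] := IHn (B y).
by rewrite iterSr; split; [split; rewrite ?en | rewrite /= en ABK].
Qed.

Lemma iter_inv_op_pow {n : nat} {x : H} :
  dom (A ^+ n) x -> iter n B ((A ^+ n) x) = x.
Proof.
elim: n => [|n IHn] // [dn dA].
by rewrite iterSr /= BAK// IHn.
Qed.

(** Since [B^n y] lies in [dom (A ^+ n)], the inclusion applies there: [T B^n y = B^n A^n T B^n y =
    B^n T A^n B^n y = B^n T y]. *)
Lemma op_sub_comm_iter_inv {T : operator H} {n : nat} :
  dom T = [set: H]%classic -> T * A ^+ n `<=` A ^+ n * T ->
  forall y, T (iter n B y) = iter n B (T y).
Proof.
move=> domT [sub_dom eqTA] y; have [dn en] := op_pow_iter_inv n y.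
have dTA : dom (T * A ^+ n) (iter n B y) by split=> //; rewrite domT.
have [_ dAT] := sub_dom _ dTA.
rewrite -[LHS](iter_inv_op_pow dAT); congr (iter n B _).
by have /= <- := eqTA _ dTA; rewrite en.
Qed.

Lemma comm_inv_op_sub {T : operator H} :
  dom T = [set: H]%classic -> (forall y, T (B y) = B (T y)) ->
  T * A `<=` A * T.
Proof.
move=> domT TB.
(* This puts [T x] in the range of [B], hence in [dom A]. *)
have TE x : dom A x -> T x = B (T (A x)) by move=> dx; rewrite -TB BAK.
split=> [x [dx _]|x [dx _]] /=; last by rewrite (TE _ dx) ABK.
by split; rewrite ?domT ?(TE _ dx).
Qed.

End InverseOperator.

Theorem proposition2p23 (R : realType) (H : hilbertType R)
    (A T : operator H) (p q : nat) :
  boundedly_invertible A -> bounded_everywhere T ->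
  (0 < p)%N -> (0 < q)%N -> coprime p q ->
  T * A ^+ p `<=` A ^+ p * T ->
  T * A ^+ q `<=` A ^+ q * T ->
  T * A `<=` A * T.
Proof.
move=> [B [[domB _] [_ [subIAB eqAB]] [_ eqBA]]] [domT _] p_gt0 _ pq1 TAp TAq.
(* The domain half of the inclusion of [op_id] in [A * B] says that [B] maps all of [H] into
   [dom A]. *)
have domAB y : dom A (B y) by have [] := subIAB y I.
have ABK y : A (B y) = y by exact: esym (eqAB y I).
have BAK x : dom A x -> B (A x) = x by move=> dx; apply: eqBA; rewrite /= domB.
apply: (comm_inv_op_sub A B domAB ABK BAK domT).
apply: (comp_iter_coprime (can_inj ABK) p_gt0 pq1).
- exact: (op_sub_comm_iter_inv A B domAB ABK BAK domT TAp).
- exact: (op_sub_comm_iter_inv A B domAB ABK BAK domT TAq).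
Qed.
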